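(* There does not exist any $C^1$ smooth surface ($2$-dimensional $C^1$ submanifold) of degree $2$ in the Engel group $\mathbb{E}$.
   Context: $\mathbb{E}$ is the connected, simply connected Lie group whose Lie algebra has a basis $(X_1,X_2,X_3,X_4)$ of left invariant vector fields with only nontrivial brackets $[X_1,X_2]=X_3$, $[X_1,X_3]=X_4$. The degrees of $X_1,X_2,X_3,X_4$ are $d_1=d_2=1$, $d_3=2$, $d_4=3$. For a $2$-dimensional $C^1$ submanifold $\Sigma\subset\mathbb{E}$ and $p\in\Sigma$, take a basis $(t_1,t_2)$ of $T_p\Sigma$ and write $t_1\wedge t_2=\sum_{i<j}c_{ij}X_i(p)\wedge X_j(p)$. The pointwise degree is $d_\Sigma(p)=\max\{d_i+d_j:c_{ij}\neq0\}$ and the degree of $\Sigma$ is $d(\Sigma)=\max_{p\in\Sigma}d_\Sigma(p)$. *)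

(* Defs.v *)
From mathcomp Require Import all_boot all_order all_algebra.
From mathcomp Require Import ring.
From mathcomp Require Import all_classical all_reals all_analysis.

Set Implicit Arguments.
Unset Strict Implicit.
Unset Printing Implicit Defensive.

Import Order.TTheory GRing.Theory Num.Theory.
Import numFieldNormedType.Exports.

Local Open Scope classical_set_scope.
Local Open Scope ring_scope.

(** Embedded C^1 submanifolds of R^n *)

Definition C1_on (R : realType) (m n : nat) (V : set 'rV[R]_m)
    (f : 'rV[R]_m -> 'rV[R]_n) : Prop :=
  forall u, V u ->
    differentiable f u /\
    forall w, {for u, continuous (fun x => 'd f x w : 'rV[R]_n)}.

(* phi is a regular C^1 parametrization of S `&` U, defined on the open set V;
   psi witnesses that it is a homeomorphism onto its image. *)
Definition local_parametrization (R : realType) (k n : nat) (S : set 'rV[R]_n)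
    (V : set 'rV[R]_k) (U : set 'rV[R]_n) (phi : 'rV[R]_k -> 'rV[R]_n) : Prop :=
  [/\ open V, open U, phi @` V = S `&` U &
   [/\ C1_on V phi,
     forall u, V u -> injective ('d phi u : 'rV[R]_k -> 'rV[R]_n) &
     exists psi : 'rV[R]_n -> 'rV[R]_k,
       (forall u, V u -> psi (phi u) = u) /\
       {within S `&` U, continuous psi}]].

Definition C1_submanifold (R : realType) (k n : nat) (S : set 'rV[R]_n) : Prop :=
  forall p, S p -> exists V U (phi : 'rV[R]_k -> 'rV[R]_n),
    U p /\ local_parametrization S V U phi.

(* Velocities at p of the C^1 curves of S through p. *)
Definition tangent_space (R : realType) (n : nat) (S : set 'rV[R]_n)
    (p : 'rV[R]_n) : set 'rV[R]_n :=
  [set v | exists g : R -> 'rV[R]_n,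
     [/\ g 0 = p,
         \forall t \near (0 : R),
           [/\ S (g t), derivable g t 1 & {for t, continuous (g^`())%classic}] &
         (g^`())%classic 0 = v]].

Definition basis2 (R : realType) (n : nat) (T : set 'rV[R]_n)
    (t1 t2 : 'rV[R]_n) : Prop :=
  row_free (col_mx t1 t2) /\ T = [set v | (v <= col_mx t1 t2)%MS].

(* Bivectors of R^n are represented by alternating matrices. *)
Definition wedge (R : realType) (n : nat) (u v : 'rV[R]_n) : 'M[R]_n :=
  u^T *m v - v^T *m u.

Definition lie_bracket (R : realType) (n : nat) (X Y : 'rV[R]_n -> 'rV[R]_n)
    (p : 'rV[R]_n) : 'rV[R]_n :=
  'd Y p (X p) - 'd X p (Y p).

(** The Engel group *)

(* R^4 with the group law of exponential coordinates of the second kind: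
   (x_1,x_2,x_3,x_4) stands for exp(x_4 X_4 + x_3 X_3 + x_2 X_2) exp(x_1 X_1).
   Indices are shifted by one: 0, 1, 2, 3 : 'I_4 stand for 1, 2, 3, 4. *)
Definition engel_mul (R : realType) (x y : 'rV[R]_4) : 'rV[R]_4 :=
  \row_j [:: x 0 0 + y 0 0;
             x 0 1 + y 0 1;
             x 0 2 + y 0 2 + x 0 0 * y 0 1;
             x 0 3 + y 0 3 + x 0 0 * y 0 2 + x 0 0 ^+ 2 / 2 * y 0 1]`_j.

Definition engel_inv (R : realType) (x : 'rV[R]_4) : 'rV[R]_4 :=
  \row_j [:: - x 0 0;
             - x 0 1;
             - x 0 2 + x 0 0 * x 0 1;
             - x 0 3 + x 0 0 * x 0 2 - x 0 0 ^+ 2 / 2 * x 0 1]`_j.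

(* The left invariant vector field X_i : the differential at the identity of
   the left translation by p, applied to the i-th coordinate vector. *)
Definition engel_field (R : realType) (i : 'I_4) (p : 'rV[R]_4) : 'rV[R]_4 :=
  'd (engel_mul p) (0 : 'rV[R]_4) (delta_mx 0 i).

Definition engel_deg (i : 'I_4) : nat := nth 0%N [:: 1; 1; 2; 3]%N i.

(* The degree k does not depend on the choice of (t1, t2), and c i j is
   uniquely determined for i < j; its other entries play no role. *)
Definition pointwise_degree (R : realType) (S : set 'rV[R]_4) (p : 'rV[R]_4)
    (k : nat) : Prop :=
  exists (t1 t2 : 'rV[R]_4) (c : 'I_4 -> 'I_4 -> R),
    [/\ basis2 (tangent_space S p) t1 t2,
        wedge t1 t2 = \sum_(i < 4) \sum_(j < 4 | (i < j)%N)
          c i j *: wedge (engel_field i p) (engel_field j p) &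
        k = (\max_(i < 4) \max_(j < 4 | (i < j) && (c i j != 0)%R)
          (engel_deg i + engel_deg j))%N].

(* k is the maximum, attained on S, of the pointwise degrees. *)
Definition degree (R : realType) (S : set 'rV[R]_4) (k : nat) : Prop :=
  (exists p, S p /\ pointwise_degree S p k) /\
  forall p l, S p -> pointwise_degree S p l -> (l <= k)%N.

(** The above is the Engel group, with X_1, X_2, X_3, X_4 the given basis of
    its Lie algebra *)

Lemma row4P (R : realType) (x y : 'rV[R]_4) :
  x 0 0 = y 0 0 -> x 0 1 = y 0 1 -> x 0 2 = y 0 2 -> x 0 3 = y 0 3 -> x = y.
Proof.
move=> h0 h1 h2 h3; apply/rowP => -[m hm].
case: m hm => [|[|[|[|//]]]] hm.
- by rewrite (_ : Ordinal hm = 0) //; apply: val_inj.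
- by rewrite (_ : Ordinal hm = 1) //; apply: val_inj.
- by rewrite (_ : Ordinal hm = 2) //; apply: val_inj.
- by rewrite (_ : Ordinal hm = 3) //; apply: val_inj.
Qed.

Lemma engel_mulA (R : realType) : associative (@engel_mul R).
Proof. by move=> x y z; apply: row4P; rewrite !mxE /=; field. Qed.

Lemma engel_mul0g (R : realType) : left_id 0 (@engel_mul R).
Proof. by move=> x; apply: row4P; rewrite !mxE /=; field. Qed.

Lemma engel_mulg0 (R : realType) : right_id 0 (@engel_mul R).
Proof. by move=> x; apply: row4P; rewrite !mxE /=; field. Qed.

Lemma engel_mulVg (R : realType) : left_inverse 0 (@engel_inv R) (@engel_mul R).
Proof. by move=> x; apply: row4P; rewrite !mxE /=; field. Qed.

Lemma engel_mulgV (R : realType) : right_inverse 0 (@engel_inv R) (@engel_mul R).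
Proof. by move=> x; apply: row4P; rewrite !mxE /=; field. Qed.

(* X_1, X_2, X_3, X_4 in coordinates, as the rows of a matrix *)
Definition engel_frame (R : realType) (p : 'rV[R]_4) : 'M[R]_4 :=
  \matrix_(i, j) (nth [::]
    [:: [:: 1; 0; 0; 0];
        [:: 0; 1; p 0 0; p 0 0 ^+ 2 / 2];
        [:: 0; 0; 1; p 0 0];
        [:: 0; 0; 0; 1]] i)`_j.

Lemma ordE4 : [/\ ord0 = 0 :> 'I_4, lift ord0 ord0 = 1 :> 'I_4,
  lift ord0 (lift ord0 ord0) = 2 :> 'I_4 &
  lift ord0 (lift ord0 (lift ord0 ord0)) = 3 :> 'I_4].
Proof. by split; exact: val_inj. Qed.

Lemma engel_mulE (R : realType) (p y : 'rV[R]_4) :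
  engel_mul p y = p + y *m engel_frame p.
Proof.
case: ordE4 => e0 e1 e2 e3.
by apply: row4P; rewrite !mxE !big_ord_recl big_ord0 e3 e2 e1 e0 !mxE /=; ring.
Qed.

Lemma mulmxr_continuous (R : realType) (m n : nat) (A : 'M[R]_(m, n)) :
  continuous (fun v : 'rV[R]_m => v *m A).
Proof.
move=> v; have -> : (fun v => v *m A) = \sum_(i < m) (fun v : 'rV[R]_m => v 0 i *: row i A).
  by apply/funext => w; rewrite fct_sumE mulmx_sum_row.
apply: differentiable_continuous; apply: differentiable_sum => i.
by apply: differentiableZl; exact: differentiable_coord.
Qed.

Lemma engel_fieldE (R : realType) (i : 'I_4) (p : 'rV[R]_4) :
  engel_field i p = row i (engel_frame p).
Proof.
rewrite /engel_field (_ : engel_mul p = cst p + mulmxr (engel_frame p)); last first.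
  by apply/funext => y; exact: engel_mulE.
have c := @mulmxr_continuous R _ _ (engel_frame p).
have d : differentiable (mulmxr (engel_frame p) : 'rV[R]_4 -> _) 0.
  exact: linear_differentiable.
have d1 : is_diff (0 : 'rV[R]_4) (mulmxr (engel_frame p) : 'rV[R]_4 -> _)
    (mulmxr (engel_frame p)) by apply: DiffDef d _; exact: diff_lin.
have dD := is_diffD (is_diff_cst p (0 : 'rV[R]_4)) d1.
rewrite (diff_val (is_diff_def := dD)) !fctE /=.
by rewrite add0r -rowE.
Qed.

Lemma engel_field_basis (R : realType) (p : 'rV[R]_4) :
  \matrix_i engel_field i p \in unitmx.
Proof.
have -> : \matrix_i engel_field i p = engel_frame p.
  by apply/row_matrixP => i; rewrite rowK engel_fieldE.
rewrite unitmxE -det_tr det_trig.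
  case: ordE4 => e0 e1 e2 e3.
  by rewrite !big_ord_recl big_ord0 e3 e2 e1 e0 !mxE /= !mulr1 unitr1.
apply/is_trig_mxP => -[[|[|[|[|//]]]] ?] [[|[|[|[|//]]]] ?] //= _;
  by rewrite !mxE.
Qed.

(* the derivative of x_1 |-> row i (engel_frame x) *)
Definition engel_dframe (R : realType) (p : 'rV[R]_4) : 'M[R]_4 :=
  \matrix_(i, j) (nth [::]
    [:: [:: 0; 0; 0; 0];
        [:: 0; 0; 1; p 0 0];
        [:: 0; 0; 0; 1];
        [:: 0; 0; 0; 0]] i)`_j.

Lemma engel_field_diff (R : realType) (i : 'I_4) (p v : 'rV[R]_4) :
  'd (@engel_field R i) p v = v 0 0 *: row i (engel_dframe p).
Proof.
pose x : 'rV[R]_4 -> R := fun q => q 0 0.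
pose a := row i (engel_frame (0 : 'rV[R]_4)).
pose b := row i (engel_dframe (0 : 'rV[R]_4)).
pose c := row i (engel_dframe (const_mx 1)) - b.
have -> : @engel_field R i =
    cst a + ((fun q => x q *: b) + (fun q => ((2^-1 *: (x ^+ 2)) q) *: c)).
  apply/funext => q; rewrite engel_fieldE.
  by case: i @a @b @c => -[|[|[|[|//]]]] ? a b c; apply: row4P;
    rewrite !(fctE, mxE) /= ?mxE /= /x -?[_ *: _]/(_ * _); field.
have dx : differentiable x p by exact: differentiable_coord.
have xl : 'd x p v = v 0 0.
  have @f : {linear 'rV[R]_4 -> R}.
    by exists (fun q : 'rV[R]_4 => q 0 0); do 2![eexists]; do ?[constructor];
      rewrite ?mxE // => ? *; rewrite ?mxE//; move=> ?; rewrite !mxE.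
  rewrite (_ : x = f) // diff_lin //; exact: coord_continuous.
have dx2 : differentiable (2^-1 *: (x ^+ 2)) p.
  by apply: differentiableZ; exact: differentiableX.
have x2l : 'd (2^-1 *: (x ^+ 2)) p v = p 0 0 * v 0 0.
  rewrite diffZ; last exact: differentiableX.
  rewrite [LHS]/= diffX //=.
  have -> : x p = p 0 0 by [].
  by rewrite xl expr1 scalerA mulKf.
have d1 : differentiable (fun q => x q *: b) p by exact: differentiableZl.
have d2 : differentiable (fun q => (2^-1 *: (x ^+ 2)) q *: c) p.
  exact: differentiableZl.
pose ev (f : 'rV[R]_4 -> 'rV[R]_4) := f v.
have e1 : 'd (fun q => x q *: b) p v = v 0 0 *: b.
  by rewrite -xl; exact: (congr1 ev (diffZl b dx)).
have e2 : 'd (fun q => (2^-1 *: (x ^+ 2)) q *: c) p v = (p 0 0 * v 0 0) *: c.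
  by rewrite -x2l; exact: (congr1 ev (diffZl c dx2)).
apply: etrans (congr1 ev (diffD (differentiable_cst a p)
  (differentiableD d1 d2))) _.
apply: etrans (congr1 (+%R _) (congr1 ev (diffD d1 d2))) _.
apply: etrans (congr1 (+%R^~ _) (congr1 ev (diff_cst a p))) _.
apply: etrans (add0r _) _; apply: etrans (congr2 +%R e1 e2) _.
rewrite /c /b; clear -i p v.
by case: i => -[|[|[|[|//]]]] ?; apply: row4P; rewrite !mxE /=; ring.
Qed.

Lemma engel_brackets (R : realType) (i j : 'I_4) : (i < j)%N ->
  lie_bracket (@engel_field R i) (@engel_field R j) =
    if (i == 0) && (j == 1) then @engel_field R 2
    else if (i == 0) && (j == 2) then @engel_field R 3
    else cst 0.
Proof.
move=> ij; apply/funext => p.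
apply: (etrans (congr2 (fun u v => u - v)
  (engel_field_diff j p _) (engel_field_diff i p _))).
rewrite !engel_fieldE.
case: i ij => -[|[|[|[|//]]]] ?; case: j => -[|[|[|[|//]]]] ? //= _;
  by rewrite ?engel_fieldE; apply: row4P; rewrite !mxE /=; ring.
Qed.

(* Main.v *)
Require Import Defs.
From mathcomp Require Import all_boot all_order all_algebra.
From mathcomp Require Import ring lra.
From mathcomp Require Import all_classical all_reals all_analysis.

(** A surface of degree 2 would be everywhere tangent to the plane field spanned
    by X_1 and X_2, and this plane field is not integrable, because [X_1, X_2] =
    X_3 is transverse to it. The point is to see that C^1 regularity suffices for
    the non-integrability.

    In the coordinates used here X_1 = d_1 and X_2 = d_2 + x_1 d_3 + (x_1^2/2) d_4.
    If phi is a local parametrization of the surface, tangency gives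
    d phi_3 = phi_1 d phi_2, while d phi_1 and d phi_2 are linearly independent.
    If phi were C^2, taking the exterior derivative would give
    0 = d phi_1 /\ d phi_2, a contradiction. For phi of class C^1, fix a point u
    and set G = phi_3 - phi_1(u) phi_2. Then
    dG = (phi_1 - phi_1(u)) d phi_2 is the product of a function that is
    differentiable at u and vanishes there with a merely continuous one, hence it
    is differentiable at u ([is_diffM_vanishing]), with derivative
    d phi_1 (x) d phi_2. A function that is twice differentiable at a single point
    has a symmetric second derivative there ([Clairaut]), so
    d phi_1 /\ d phi_2 = 0 at u all the same ([contact_diff_dependent]).

    It remains to deduce tangency from the degree. The tangent space of velocities
    of curves is the image of the differential of phi ([tangent_space_sub],
    [sub_tangent_space]); therefore the pointwise degree exists at every point of
    the surface, and the bound on it kills all the components of the tangent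
    bivector except the one along X_1 /\ X_2 ([degree_le2_horizontal]). *)

Set Implicit Arguments.
Unset Strict Implicit.
Unset Printing Implicit Defensive.

Import Order.TTheory GRing.Theory Num.Theory.
Import numFieldNormedType.Exports.

Local Open Scope classical_set_scope.
Local Open Scope ring_scope.

(** * Second derivatives at a point *)

Section SecondDerivative.
Context {R : realType}.
Implicit Types V W : normedModType R.

Lemma diff_near V W (f : V -> W) (u : V) : differentiable f u ->
  forall e, 0 < e ->
    \forall h \near (0 : V), `|f (h + u) - (f u + 'd f u h)| <= e * `|h|.
Proof. by move=> /diff_locally/eqaddoP fu e e0; exact: fu. Qed.

Lemma is_diff_near V W (f : V -> W) (df : {linear V -> W}) (u : V) :
  continuous df ->
  (forall e, 0 < e ->
    \forall h \near (0 : V), `|f (h + u) - (f u + df h)| <= e * `|h|) ->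
  is_diff u f df.
Proof.
move=> dfc dfe; have dfl : f \o shift u = cst (f u) + df +o_ 0 id.
  by apply/eqaddoP => e e0; exact: dfe.
have dE := diff_unique dfc dfl.
apply: DiffDef; last exact: dE.
by apply/diff_locallyP; rewrite dE.
Qed.

Lemma near_eq_is_diff V W (f g df : V -> W) (u : V) :
  (\forall x \near u, f x = g x) -> is_diff u f df -> is_diff u g df.
Proof.
move=> fg [fu dfE].
suff gu : is_diff u g ('d f u) by apply: is_diff_eq gu _; rewrite dfE.
apply: is_diff_near; first exact: diff_continuous.
move=> e e0; have fgu : f u = g u by exact: (nbhs_singleton fg).
move: fg; rewrite (near_shift 0) subr0 => fg.
apply: filterS2 fg (diff_near fu e0) => h /= <-.
by rewrite fgu.
Qed.

(** m need only be continuous: since k vanishes at u, replacing m by its value at u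
    costs O(|h|) * o(1). This is where a factor of class C^0 still yields a
    differentiable product. *)
Lemma is_diffM_vanishing V (k m : V -> R) (u : V) :
  differentiable k u -> k u = 0 -> {for u, continuous m} ->
  is_diff u (fun x => k x * m x) (fun v => 'd k u v * m u).
Proof.
move=> dk k0 cm.
pose L : {linear V -> R} := (m u \*: 'd k u).
have LE : (fun v => 'd k u v * m u) = L.
  by apply/funext => v; rewrite mulrC.
rewrite LE; have [C C0 hC] := linear_lipschitz (diff_continuous dk).
have Lc : continuous L.
  by move=> v; rewrite -LE; apply: cvgMl; exact: diff_continuous.
apply: is_diff_near => // e e0.
pose M := `|m u| + 1.
have M0 : 0 < M by rewrite ltr_wpDl.
have e1 : 0 < e / (2 * M) by rewrite divr_gt0 // mulr_gt0.
have e2 : 0 < Num.min 1 (e / (2 * C)).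
  by rewrite lt_min ltr01 divr_gt0 // mulr_gt0.
have nk := diff_near dk e1.
have nm : \forall h \near (0 : V), `|m u - m (h + u)| < Num.min 1 (e / (2 * C)).
  have : \forall t \near u, `|m u - m t| < Num.min 1 (e / (2 * C)).
    by have /cvgrPdist_lt/(_ _ e2) := cm.
  by rewrite (near_shift 0) subr0; exact.
apply: filterS2 nk nm => h; rewrite k0 add0r mul0r add0r => hk.
rewrite lt_min => /andP[hm1 /ltW hm2].
have hm : `|m (h + u)| <= M.
  rewrite -[m (h + u)](subKr (m u)); apply: le_trans (ler_normB _ _) _.
  by rewrite lerD // ltW.
have -> : k (h + u) * m (h + u) - L h =
    (k (h + u) - 'd k u h) * m (h + u) - 'd k u h * (m u - m (h + u)).
  by rewrite -[L h]/(m u * 'd k u h); ring.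
apply: le_trans (ler_normB _ _) _; rewrite !normrM.
have t1 := ler_pM (normr_ge0 _) (normr_ge0 _) hk hm.
have t2 := ler_pM (normr_ge0 _) (normr_ge0 _) (hC h) hm2.
apply: le_trans (lerD t1 t2) _; rewrite le_eqVlt; apply/orP; left; apply/eqP.
by field; rewrite !gt_eqF.
Qed.

Lemma derive_along V W (G : V -> W) (a w : V) (t : R) :
  differentiable G (a + t *: w) ->
  is_derive t 1 (fun s => G (a + s *: w)) ('d G (a + t *: w) w).
Proof.
move=> dG.
have dl : is_diff t (fun s : R => a + s *: w) (fun s => s *: w).
  apply: (is_diff_eq _); by rewrite add0r.
have dc := @is_diff_comp R R V W _ _ _ _ t dl (differentiableP dG).
apply: DeriveDef; first exact: diff_derivable.
rewrite deriveE //; by rewrite diff_val /= scale1r.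
Qed.

(** The second difference of G over the parallelogram spanned by h v and h w is, by
    the mean value theorem in the direction of w, h times an increment of 'd G _ w
    in the direction of v; differentiability of 'd G _ w at the single point u
    evaluates that increment up to o(h). *)
Lemma second_difference V (G : V -> R) (u v w : V) :
  (\forall x \near u, differentiable G x) ->
  differentiable (fun x => 'd G x w : R) u ->
  forall e, 0 < e -> \forall h \near 0^'+,
    `|G (u + h *: v + h *: w) - G (u + h *: v) - (G (u + h *: w) - G u)
      - h ^+ 2 * 'd (fun x => 'd G x w : R) u v| <= e * h ^+ 2.
Proof.
pose m x : R := 'd G x w; change (fun x => 'd G x w : R) with m; move=> nG dm e e0.
pose N := `|v| + `|w| + 1.
have N0 : 0 < N by rewrite /N ltr_wpDl // addr_ge0.
have e'0 : 0 < e / (2 * N) by rewrite divr_gt0 // mulr_gt0.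
have nm := diff_near dm e'0.
have /nbhs_normP[d /= d0 H] : \forall y \near (0 : V),
    differentiable G (y + u) /\
    `|m (y + u) - (m u + 'd m u y)| <= e / (2 * N) * `|y|.
  apply: filterS2 nm; last first.
    by move: nG; rewrite (near_shift 0) subr0; exact.
  by move=> y h1 h2; split => //; move: h1; rewrite /= subr0.
near=> h.
have h0 : 0 < h by near: h; exact: nbhs_right_gt.
have hd : h * N < d.
  rewrite -ltr_pdivlMr //; near: h; apply: nbhs_right_lt; exact: divr_gt0.
have bnd s t : 0 <= s <= h -> 0 <= t <= h -> `|s *: v + t *: w| <= h * N.
  move=> /andP[s0 sh] /andP[t0 th]; apply: (le_trans (ler_normD _ _)).
  rewrite !normrZ !ger0_norm // /N !mulrDr mulr1.
  by rewrite ler_wpDr ?(ltW h0) // lerD // ler_wpM2r.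
have {}H s t : 0 <= s <= h -> 0 <= t <= h ->
    differentiable G (u + s *: v + t *: w) /\
    `|m (u + s *: v + t *: w) - (m u + (s * 'd m u v + t * 'd m u w))|
      <= e / 2 * h.
  move=> hs ht; have b := bnd _ _ hs ht.
  have [] := H (s *: v + t *: w).
    by rewrite /ball_ /= sub0r normrN (le_lt_trans b).
  rewrite addrC addrA (linearD ('d m u)) !linearZ /= => ? h2; split => //.
  apply: le_trans h2 _; apply: le_trans (ler_wpM2l (ltW e'0) b) _.
  by rewrite le_eqVlt; apply/orP; left; apply/eqP; field; rewrite gt_eqF.
pose k (t : R) : R := G (u + h *: v + t *: w) - G (u + t *: w).
pose dk (t : R) : R := m (u + h *: v + t *: w) - m (u + t *: w).
have hh : 0 <= h <= h by rewrite lexx ltW.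
have h00 : 0 <= (0 : R) <= h by rewrite lexx ltW.
have kd t : 0 <= t <= h -> is_derive t 1 k (dk t).
  move=> ht; apply: is_deriveB.
    by apply: derive_along; have [] := H _ _ hh ht.
  apply: derive_along; have [] := H _ _ h00 ht.
  by rewrite scale0r addr0.
have [||c] := @MVT R k dk 0 h h0.
- by move=> x; rewrite in_itv /= => /andP[? ?]; apply: kd; rewrite !ltW.
- apply: derivable_within_continuous => x; rewrite in_itv /= => hx.
  exact: (@ex_derive _ _ _ _ _ _ _ (kd _ hx)).
rewrite in_itv /= => /andP[c0 ch] kE.
have hc : 0 <= c <= h by rewrite !ltW.
have [_ e1] := H _ _ hh hc.
have [_ e2] := H _ _ h00 hc.
rewrite scale0r addr0 mul0r add0r in e2.
have -> : G (u + h *: v + h *: w) - G (u + h *: v) - (G (u + h *: w) - G u) =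
  k h - k 0 by rewrite /k !scale0r !addr0; ring.
rewrite kE subr0 /dk expr2.
move: e1 e2; set p := m _; set q := m (_ + _); set dv := 'd m u v.
set dw := 'd m u w => e1 e2.
have -> : (p - q) * h - h * h * dv =
  ((p - (m u + (h * dv + c * dw))) - (q - (m u + c * dw))) * h by ring.
rewrite normrM (gtr0_norm h0) mulrA ler_wpM2r ?(ltW h0) //.
apply: le_trans (ler_normB _ _) _; apply: le_trans (lerD e1 e2) _.
by rewrite -mulrDl -splitr.
Unshelve. all: by end_near. Qed.

(** The second difference is symmetric in v and w, so its two asymptotic
    evaluations must agree. *)
Lemma Clairaut V (G : V -> R) (u v w : V) :
  (\forall x \near u, differentiable G x) ->
  differentiable (fun x => 'd G x v : R) u ->
  differentiable (fun x => 'd G x w : R) u ->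
  'd (fun x => 'd G x w : R) u v = 'd (fun x => 'd G x v : R) u w.
Proof.
move=> nG dv dw; set A := LHS; set B := RHS.
apply/eqP; rewrite -subr_eq0 -normr_le0; apply/ler_addgt0Pr => e e0.
have e2 : 0 < e / 2 by rewrite divr_gt0.
have d1 := second_difference v nG dw e2.
have d2 := second_difference w nG dv e2.
have /filter_ex[h [h0]] : \forall h \near (0 : R)^'+,
    0 < h /\ `|h ^+ 2 * (A - B)| <= h ^+ 2 * (0 + e).
  apply: filterS3 (nbhs_right_gt 0) d1 d2 => h h0.
  rewrite -/A -/B (addrAC u) => h1 h2; split => //.
  have -> : h ^+ 2 * (0 + e) = e / 2 * h ^+ 2 + e / 2 * h ^+ 2 by field.
  apply: le_trans (lerD h1 h2); rewrite [leRHS]addrC.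
  apply: le_trans (ler_normB _ _).
  rewrite le_eqVlt; apply/orP; left; apply/eqP; congr `|_|; ring.
by rewrite normrM ger0_norm ?sqr_ge0 // ler_pM2l // exprn_gt0.
Qed.

(** Clairaut's theorem applied to G = h - f(u) g, whose differential
    (f - f(u)) dg has derivative df (x) dg at u. This replaces the exterior
    derivative of dh = f dg, which is not available for g of class C^1. *)
Lemma contact_diff_dependent V (f g h : V -> R) (u v w : V) :
  differentiable f u ->
  (\forall x \near u, [/\ differentiable g x, differentiable h x &
    forall y, 'd h x y = f x * 'd g x y]) ->
  (forall y, {for u, continuous (fun x => 'd g x y : R)}) ->
  'd f u v * 'd g u w = 'd f u w * 'd g u v.
Proof.
move=> df ngh cg.
pose G := h - f u *: g; pose k x := f x - f u.
have nG : \forall x \near u, differentiable G x /\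
    forall y, 'd G x y = k x * 'd g x y.
  apply: filterS ngh => x [dg dh hE].
  have dG := is_diffB (differentiableP dh) (is_diffZ (f u) (differentiableP dg)).
  split; first exact: (ex_diff (is_diff_def := dG)).
  by move=> y; rewrite (diff_val (is_diff_def := dG)) !fctE hE /k mulrBl.
have dk : is_diff u k ('d f u).
  have := is_diffB (differentiableP df) (is_diff_cst (f u) u).
  by rewrite subr0; exact.
have dG y : is_diff u (fun x => 'd G x y : R) (fun z => 'd f u z * 'd g u y).
  have k0 : k u = 0 by rewrite /k subrr.
  have := is_diffM_vanishing (ex_diff (is_diff_def := dk)) k0 (cg y).
  rewrite (diff_val (is_diff_def := dk)); apply: near_eq_is_diff.
  by apply: filterS nG => x [_ ->].
have nG1 : \forall x \near u, differentiable G x by apply: filterS nG => x [].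
have ddG y z : 'd (fun x => 'd G x y : R) u z = 'd f u z * 'd g u y.
  exact: (congr1 (fun L : V -> R => L z) (diff_val (is_diff_def := dG y))).
have clairaut := Clairaut nG1 (ex_diff (is_diff_def := dG v))
  (ex_diff (is_diff_def := dG w)).
exact: etrans (esym (ddG w v)) (etrans clairaut (ddG v w)).
Qed.

End SecondDerivative.

(** * Tangent spaces of parametrized submanifolds *)

Section TangentSpace.
Context {R : realType}.
Implicit Types V W : normedModType R.

Lemma near_eq_continuous (T X : topologicalType) (f g : T -> X) (x : T) :
  (\forall y \near x, f y = g y) ->
  {for x, continuous f} -> {for x, continuous g}.
Proof.
move=> fg cf; change (g @ x --> g x).
have <- : f x = g x := nbhs_singleton fg.
exact: cvg_trans (near_eq_cvg fg) cf.
Qed.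

Lemma is_diff_coord V n (phi : V -> 'rV[R]_n) (x : V) (i : 'I_n) :
  differentiable phi x ->
  is_diff x (fun y => phi y 0 i : R) (fun w => 'd phi x w 0 i).
Proof.
move=> dphi; have dc := differentiable_coord (phi x) 0 i.
have cE : 'd (fun N : 'rV[R]_n => N 0 i : R) (phi x) = (fun N => N 0 i) :> ('rV[R]_n -> R).
  have @f : {linear 'rV[R]_n -> R}.
    by exists (fun q : 'rV[R]_n => q 0 i); do 2![eexists]; do ?[constructor];
      rewrite ?mxE // => ? *; rewrite ?mxE//; move=> ?; rewrite !mxE.
  rewrite (_ : (fun _ => _) = f) // diff_lin //; exact: coord_continuous.
have := is_diff_comp (differentiableP dphi) (differentiableP dc).
by rewrite cE.
Qed.

Lemma range_diff m n (phi : 'rV[R]_m -> 'rV[R]_n) u :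
  range ('d phi u) = [set v | (v <= 'J phi u)%MS].
Proof.
apply/seteqP; split => [v [w _ <-]|v /= /submxP[w ->]].
  by rewrite /= -[X in (X <= _)%MS]mul_rV_lin1 submxMl.
by exists w => //; rewrite mul_rV_lin1.
Qed.

Lemma jacobian_row_free m n (phi : 'rV[R]_m -> 'rV[R]_n) u :
  injective ('d phi u : 'rV[R]_m -> 'rV[R]_n) -> row_free ('J phi u).
Proof.
move=> inj; rewrite -kermx_eq0; apply/eqP/row_matrixP => i.
rewrite row0; apply: inj; rewrite linear0 -mul_rV_lin1.
by rewrite -row_mul mulmx_ker row0.
Qed.

Lemma mulmxr_lipschitz m n (A : 'M[R]_(m, n)) :
  exists2 C, 0 < C & forall x : 'rV[R]_m, `|x *m A| <= C * `|x|.
Proof.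
have [C C0 hC] := linear_lipschitz (f := mulmxr A) (@mulmxr_continuous R _ _ A).
by exists C.
Qed.

(** An affine line in the parameter domain is mapped to a C^1 curve of S with any
    prescribed velocity in the image of the differential. *)
Lemma sub_tangent_space k n (S U : set 'rV[R]_n) (V : set 'rV[R]_k)
    (phi : 'rV[R]_k -> 'rV[R]_n) u :
  local_parametrization S V U phi -> V u ->
  [set v | (v <= 'J phi u)%MS] `<=` tangent_space S (phi u).
Proof.
case=> oV _ im [C1 _ _] Vu; rewrite -range_diff => _ [w _ <-].
pose l (t : R) := u + t *: w.
have cl : continuous l.
  by move=> t; apply: cvgD; [exact: cvg_cst|apply: cvgZr_tmp; exact: cvg_id].
have Vl : \forall t \near (0 : R), V (l t).
  by apply: cl; apply: open_nbhs_nbhs; split=> //; rewrite /l scale0r addr0.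
pose dg t := 'd phi (l t) w.
have gd t : V (l t) -> is_derive t 1 (phi \o l) (dg t).
  by move=> /C1[? _]; exact: derive_along.
exists (phi \o l); split.
- by rewrite /= /l scale0r addr0.
- apply: filterS (near_join Vl) => t nt.
  have Vt := nbhs_singleton nt.
  split.
  + suff [] : (S `&` U) (phi (l t)) by [].
    by rewrite -im; exists (l t).
  + exact: (@ex_derive _ _ _ _ _ _ _ (gd _ Vt)).
  + have e : \forall s \near t, dg s = (phi \o l)^`()%classic s.
      by apply: filterS nt => s /gd gs; rewrite derive1E derive_val.
    apply: near_eq_continuous e _.
    have [_ /(_ w) cd] := C1 _ Vt.
    exact: (continuous_comp (cl t) cd).
- have V0 := nbhs_singleton Vl.
  by rewrite derive1E (derive_val (is_derive := gd _ V0)) /dg /l scale0r addr0.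
Qed.

(** Lift the curve g to a = psi o g, which is only known to be continuous. With
    P a right inverse of the Jacobian matrix J, injectivity gives
    |a t - u| = O(|g t - g 0|) = O(t), so g t - g 0 lies in the row space of J up
    to o(t). Applying K, whose kernel is that row space, to the velocity gives 0. *)
Lemma tangent_space_sub k n (S U : set 'rV[R]_n) (V : set 'rV[R]_k)
    (phi : 'rV[R]_k -> 'rV[R]_n) u :
  local_parametrization S V U phi -> V u ->
  tangent_space S (phi u) `<=` [set v | (v <= 'J phi u)%MS].
Proof.
case=> _ oU im [C1 inj [psi [psiK cpsi]]] Vu v [g [g0 ng gv]].
have [dphi _] := C1 _ Vu.
have free := jacobian_row_free (inj _ Vu).
set J := 'J phi u in free *.
have dJ w : 'd phi u w = w *m J by rewrite -mul_rV_lin1.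
pose P := pinvmx J; pose K := cokermx J.
have JP : J *m P = 1%:M by exact: mulmxVp.
have [CP CP0 hP] := mulmxr_lipschitz P.
have [CK CK0 hK] := mulmxr_lipschitz K.
have [_ dg _] := nbhs_singleton ng.
have SU : (S `&` U) (phi u) by rewrite -im; exists u.
have cg : g @ (0 : R) --> phi u.
  rewrite -g0; apply: differentiable_continuous; exact/derivable1_diffP.
have gSU : \forall t \near (0 : R), (S `&` U) (g t).
  have gU : \forall t \near (0 : R), U (g t).
    by apply: cg; apply: open_nbhs_nbhs; split => //; case: SU.
  by apply: filterS2 ng gU => t [].
pose a t := psi (g t).
have ca : a @ (0 : R) --> u.
  move=> B; rewrite -[u in nbhs u](psiK _ Vu) => nB.
  have nB' := (subspace_continuousP _ _).1 cpsi _ SU _ nB.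
  by apply: filterS2 gSU (cg _ nB') => t h; exact.
have phia : \forall t \near (0 : R), phi (a t) = g t.
  by apply: filterS gSU => t; rewrite -im => -[x Vx /esym gx]; rewrite /a gx psiK.
rewrite /= submxE; apply/eqP.
pose M := `|v| + 1.
have M0 : 0 < M by rewrite ltr_wpDl.
apply/eqP; rewrite -normr_le0; apply/ler_addgt0Pr => e e0.
have e10 : 0 < Num.min 1 (e / (2 * CK)).
  by rewrite lt_min ltr01 divr_gt0 // mulr_gt0.
(* 1 / (2 CP) absorbs the remainder in |a t - u|; the other bound makes its
   contribution to |v *m K| at most e / 2. *)
have e20 : 0 < Num.min (1 / (2 * CP)) (e / (4 * CK * CP * M)).
  by rewrite lt_min !divr_gt0 // !mulr_gt0.
have dg0 : differentiable g 0 by exact/derivable1_diffP.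
have ng1 := diff_near dg0 e10.
have nphi : \forall t \near (0 : R), `|phi (a t) - (phi u + (a t - u) *m J)|
    <= Num.min (1 / (2 * CP)) (e / (4 * CK * CP * M)) * `|a t - u|.
  have nx : \forall x \near u, `|phi x - (phi u + (x - u) *m J)|
      <= Num.min (1 / (2 * CP)) (e / (4 * CK * CP * M)) * `|x - u|.
    rewrite (near_shift 0) subr0; apply: filterS (diff_near dphi e20) => x.
    by rewrite /= addrK -dJ.
  exact: ca nx.
have /filter_ex[t [t0 ht]] : \forall t \near (0 : R)^', t != 0 /\
    `|t| * `|v *m K| <= `|t| * (0 + e).
  near=> t; split; first by near: t; exact: nbhs_dnbhs_neq.
  have h1 : `|g t - phi u - t *: v| <= Num.min 1 (e / (2 * CK)) * `|t|.
    have : `|g (t + 0) - (g 0 + 'd g 0 t)| <= Num.min 1 (e / (2 * CK)) * `|t|.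
      by near: t; exact: cvg_within ng1.
    by rewrite addr0 g0 deriv1E // gv opprD addrA.
  have h2 : `|g t - (phi u + (a t - u) *m J)|
    <= Num.min (1 / (2 * CP)) (e / (4 * CK * CP * M)) * `|a t - u|.
    rewrite -{1}(_ : phi (a t) = g t); first by near: t; exact: cvg_within nphi.
    by near: t; exact: cvg_within phia.
  set x := a t - u in h2.
  set y := g t - phi u in h1.
  pose r := y - x *m J.
  have {}h2 : `|r| <= Num.min (1 / (2 * CP)) (e / (4 * CK * CP * M)) * `|x|.
    by rewrite (_ : r = g t - (phi u + x *m J)) // /r /y opprD addrA.
  have yM : `|y| <= M * `|t|.
    have n1 := ler_normD (y - t *: v) (t *: v).
    have n2 : Num.min 1 (e / (2 * CK)) * `|t| <= `|t|.
      by rewrite ler_piMl // ge_min lexx.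
    have n3 : `|t *: v| = `|t| * `|v| by exact: normrZ.
    rewrite subrK in n1; rewrite /M mulrDl mul1r; lra.
  have xy : `|x| <= 2 * CP * `|y|.
    have xE : x = y *m P - r *m P.
      by rewrite -mulmxBl /r opprB addrCA subrr addr0 -mulmxA JP mulmx1.
    have : `|x| <= CP * `|y| + 1 / 2 * `|x|.
      rewrite {1}xE; apply: le_trans (ler_normB _ _) _; rewrite lerD //.
      apply: le_trans (hP _) _; rewrite mulrC -ler_pdivlMr //.
      apply: le_trans h2 _.
      have -> : 1 / 2 * `|x| / CP = 1 / (2 * CP) * `|x|.
        by field; rewrite gt_eqF.
      by rewrite ler_wpM2r // ge_min lexx.
    by lra.
  have rt : CK * `|r| <= e / 2 * `|t|.
    have : `|r| <= e / (4 * CK * CP * M) * (2 * CP * (M * `|t|)).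
      apply: le_trans h2 _; apply: ler_pM => //; first exact: ltW.
        by rewrite ge_min lexx orbT.
      apply: le_trans xy _; by rewrite ler_pM2l // mulr_gt0.
    move=> /(ler_wpM2l (ltW CK0))/le_trans; apply.
    by rewrite le_eqVlt; apply/orP; left; apply/eqP; field; rewrite !gt_eqF.
  have tv : CK * `|y - t *: v| <= e / 2 * `|t|.
    apply: le_trans (ler_wpM2l (ltW CK0) h1) _.
    rewrite mulrA ler_wpM2r //; have : Num.min 1 (e / (2 * CK)) <= e / (2 * CK).
      by rewrite ge_min lexx orbT.
    move=> /(ler_wpM2l (ltW CK0))/le_trans; apply.
    by rewrite le_eqVlt; apply/orP; left; apply/eqP; field; rewrite !gt_eqF.
  have -> : `|t| * `|v *m K| = `|r *m K - (y - t *: v) *m K|.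
    have -> : r = y - x *m J by [].
    rewrite -mulmxBl opprB addrCA addrAC subrr add0r mulmxDl mulNmx -mulmxA.
    by rewrite mulmx_coker mulmx0 subr0 -scalemxAl normrZ.
  apply: le_trans (ler_normB _ _) _.
  have := lerD (hK r) (hK (y - t *: v)).
  by lra.
by move: ht; rewrite ler_pM2l // normr_gt0.
Unshelve. all: by end_near. Qed.
End TangentSpace.

(** * Bivectors and the degree *)

Section Bivectors.
Context {R : realType}.

Lemma wedge_suml n (I : finType) (u : I -> 'rV[R]_n) (v : 'rV[R]_n) :
  wedge (\sum_i u i) v = \sum_i wedge (u i) v.
Proof. by rewrite /wedge (linear_sum (@trmx _ _ _)) mulmx_suml mulmx_sumr -sumrB. Qed.

Lemma wedge_sumr n (I : finType) (u : 'rV[R]_n) (v : I -> 'rV[R]_n) :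
  wedge u (\sum_i v i) = \sum_i wedge u (v i).
Proof. by rewrite /wedge (linear_sum (@trmx _ _ _)) mulmx_suml mulmx_sumr -sumrB. Qed.

Lemma wedgeZ n (a b : R) (u v : 'rV[R]_n) :
  wedge (a *: u) (b *: v) = (a * b) *: wedge u v.
Proof.
have trZ c (w : 'rV[R]_n) : (c *: w)^T = c *: w^T by rewrite linearZ.
by rewrite /wedge !trZ -!scalemxAl -!scalemxAr !scalerA (mulrC b) scalerBr.
Qed.

Lemma wedgeC n (u v : 'rV[R]_n) : wedge v u = - wedge u v.
Proof. by rewrite /wedge opprB. Qed.

(** The Pluecker coordinates of a decomposable bivector in a given frame. *)
Lemma wedge_frame n (X : 'I_n -> 'rV[R]_n) (a b : 'rV[R]_n) :
  wedge (\sum_i a 0 i *: X i) (\sum_i b 0 i *: X i) =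
  \sum_(i < n) \sum_(j < n | (i < j)%N)
    (a 0 i * b 0 j - a 0 j * b 0 i) *: wedge (X i) (X j).
Proof.
pose f i j := (a 0 i * b 0 j) *: wedge (X i) (X j).
have -> : wedge (\sum_i a 0 i *: X i) (\sum_i b 0 i *: X i) =
    \sum_i \sum_j f i j.
  rewrite wedge_suml; apply: eq_bigr => i _; rewrite wedge_sumr.
  by apply: eq_bigr => j _; rewrite wedgeZ.
have fii i : f i i = 0 by rewrite /f /wedge subrr scaler0.
transitivity (\sum_(i < n) (\sum_(j < n | (i < j)%N) f i j +
    \sum_(j < n | (j < i)%N) f i j)).
  apply: eq_bigr => i _; rewrite (bigID (fun j : 'I_n => (i < j)%N)) /=.
  congr (_ + _); rewrite (bigD1 i) ?ltnn //= fii add0r; apply: eq_bigl => j.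
  by rewrite -leqNgt ltn_neqAle andbC.
rewrite big_split /= [X in _ + X](exchange_big_dep xpredT) //= -big_split /=.
apply: eq_bigr => i _; rewrite -big_split /=; apply: eq_bigr => j _.
by rewrite /f (wedgeC (X i)) scalerN -scaleNr -scalerDl (mulrC (a 0 j)).
Qed.

Lemma wedge_neq0 n (u v : 'rV[R]_n) : row_free (col_mx u v) -> wedge u v != 0.
Proof.
move=> free; apply/eqP => /matrixP uv0.
have inj (x y : R) : x *: u + y *: v = 0 -> x = 0 /\ y = 0.
  move=> e; have : row_mx x%:M y%:M *m col_mx u v = 0 *m col_mx u v.
    by rewrite mul_row_col !mul_scalar_mx mul0mx.
  move/(row_free_inj free)/matrixP => z.
  have := z 0 (lshift 1 0); have := z 0 (rshift 1 0).
  by rewrite row_mxEl row_mxEr !mxE.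
have u0 : u = 0.
  apply/rowP => i; rewrite mxE; apply: (inj (- v 0 i) _ _).2.
  apply/rowP => j; have := uv0 i j; rewrite !mxE !big_ord1 !mxE => <-; ring.
have [] := inj 1 0; first by rewrite u0 scaler0 scale0r addr0.
by move/eqP; rewrite oner_eq0.
Qed.

(** Only (X_1, X_2) has total degree at most 2, so every other Pluecker coordinate
    of t1 /\ t2 vanishes and the remaining one does not. By the Pluecker relations
    t1 and t2 then have no X_3 component, which in coordinates reads
    t_3 = x_1 t_2. *)
Lemma degree_le2_horizontal (S : set 'rV[R]_4) (p t1 t2 : 'rV[R]_4) :
  (forall l, pointwise_degree S p l -> (l <= 2)%N) ->
  basis2 (tangent_space S p) t1 t2 ->
  [/\ t1 0 0 * t2 0 1 != t1 0 1 * t2 0 0,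
      t1 0 2 = p 0 0 * t1 0 1 & t2 0 2 = p 0 0 * t2 0 1].
Proof.
move=> deg2 bas; have [free _] := bas.
have Funit : engel_frame p \in unitmx.
  have := engel_field_basis p; congr (_ \in unitmx).
  by apply/row_matrixP => i; rewrite rowK engel_fieldE.
pose a := t1 *m invmx (engel_frame p); pose b := t2 *m invmx (engel_frame p).
pose X i := engel_field i p.
have t1E : t1 = a *m engel_frame p by rewrite /a mulmxKV.
have t2E : t2 = b *m engel_frame p by rewrite /b mulmxKV.
have sumE (x : 'rV[R]_4) : x *m engel_frame p = \sum_i x 0 i *: X i.
  by rewrite mulmx_sum_row; apply: eq_bigr => i _; rewrite /X engel_fieldE.
pose c i j := a 0 i * b 0 j - a 0 j * b 0 i.
have wE : wedge t1 t2 = \sum_(i < 4) \sum_(j < 4 | (i < j)%N)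
    c i j *: wedge (X i) (X j) by rewrite t1E t2E !sumE wedge_frame.
have c0 (i j : 'I_4) : (i < j)%N -> (2 < engel_deg i + engel_deg j)%N -> c i j = 0.
  move=> ij dij; apply/eqP; apply: contraTT dij => cij; rewrite -leqNgt.
  have := deg2 _ (ex_intro _ t1 (ex_intro _ t2 (ex_intro _ c
    (And3 bas wE erefl)))).
  move/(leq_trans _); apply.
  apply: leq_trans (leq_bigmax_cond (P := xpredT) i isT).
  have cond : (i < j)%N && (c i j != 0) by rewrite ij cij.
  exact: leq_trans (leq_bigmax_cond (P := fun j => _ && _) j cond).
case: ordE4 => e0 e1 e2 e3.
have c01 : c 0 1 != 0.
  apply: contra_neq (wedge_neq0 free) => c01; rewrite wE.
  apply: big1 => i _; apply: big1 => j ij.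
  have [d|d] := ltnP 2 (engel_deg i + engel_deg j)%N.
    by rewrite c0 // scale0r.
  have -> : i = 0.
    by move: i j ij d => [[|[|[|[|//]]]] ?] [[|[|[|[|//]]]] ?] // _ _; exact: val_inj.
  have -> : j = 1.
    by move: i j ij d => [[|[|[|[|//]]]] ?] [[|[|[|[|//]]]] ?] // _ _; exact: val_inj.
  by rewrite c01 scale0r.
have c02 : c 0 2 = 0 by exact: c0.
have c12 : c 1 2 = 0 by exact: c0.
(* (a 0 2, b 0 2) is proportional both to (a 0 0, b 0 0) and to (a 0 1, b 0 1),
   which are independent. *)
have a2 : a 0 2 = 0.
  apply: (mulIf c01); rewrite mul0r.
  have -> : a 0 2 * c 0 1 = a 0 1 * c 0 2 - a 0 0 * c 1 2 by rewrite /c; ring.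
  by rewrite c02 c12; ring.
have b2 : b 0 2 = 0.
  apply: (mulIf c01); rewrite mul0r.
  have -> : b 0 2 * c 0 1 = b 0 1 * c 0 2 - b 0 0 * c 1 2 by rewrite /c; ring.
  by rewrite c02 c12; ring.
have coord (x : 'rV[R]_4) : [/\ (x *m engel_frame p) 0 0 = x 0 0,
    (x *m engel_frame p) 0 1 = x 0 1 &
    (x *m engel_frame p) 0 2 = p 0 0 * x 0 1 + x 0 2].
  by split; rewrite !mxE !big_ord_recl big_ord0 e3 e2 e1 e0 !mxE /=; ring.
rewrite t1E t2E; have [-> -> ->] := coord a; have [-> -> ->] := coord b.
rewrite a2 b2 !addr0; split => //.
by rewrite -subr_eq0.
Qed.

End Bivectors.

(** * Surfaces of degree two *)

(** The bound on the degree at every point of S makes the chart tangent to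
    span(X_1, X_2) on all of its domain: the contact equation
    d phi_3 = phi_1 d phi_2, with d phi_1 and d phi_2 independent. *)
Lemma horizontal_chart (R : realType) (S U : set 'rV[R]_4) V
    (phi : 'rV[R]_2 -> 'rV[R]_4) (u : 'rV[R]_2) :
  (forall p l, S p -> pointwise_degree S p l -> (l <= 2)%N) ->
  local_parametrization S V U phi -> V u ->
  let D i w := 'd phi u w 0 i in
  (exists v w, D 0 v * D 1 w != D 1 v * D 0 w) /\
  forall w, D 2 w = phi u 0 0 * D 1 w.
Proof.
move=> deg2 par Vu D.
have [_ _ im [C1 inj _]] := par.
have Su : S (phi u) by suff [] : (S `&` U) (phi u) by []; rewrite -im; exists u.
pose t1 := 'd phi u (delta_mx 0 0); pose t2 := 'd phi u (delta_mx 0 1).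
have JE : col_mx t1 t2 = 'J phi u :> 'M[R]_(1 + 1, 4).
  apply/row_matrixP => i; rewrite [RHS]rowE mul_rV_lin1.
  case: (splitP i) => j.
    rewrite ord1 => ij; have -> : i = lshift 1 0 by exact: val_inj.
    by rewrite rowKu row_id; congr ('d phi u (delta_mx 0 _)); exact: val_inj.
  rewrite ord1 => ij; have -> : i = rshift 1 0 by exact: val_inj.
  by rewrite rowKd row_id; congr ('d phi u (delta_mx 0 _)); exact: val_inj.
have bas : basis2 (tangent_space S (phi u)) t1 t2.
  split; first by rewrite JE; exact: jacobian_row_free (inj _ Vu).
  rewrite JE; apply/seteqP.
  by split; [exact: tangent_space_sub par Vu|exact: sub_tangent_space par Vu].
have [ind h1 h2] := degree_le2_horizontal (fun l => @deg2 _ l Su) bas.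
split; first by exists (delta_mx 0 0), (delta_mx 0 1).
move=> w; rewrite /D.
have -> : 'd phi u w = w 0 0 *: t1 + w 0 1 *: t2.
  rewrite {1}(row_sum_delta w) !big_ord_recl big_ord0 addr0 linearD !linearZ.
  have -> : lift ord0 ord0 = 1 :> 'I_2 by exact: val_inj.
  by have -> : ord0 = 0 :> 'I_2 by exact: val_inj.
rewrite [LHS]mxE [X in _ + X]mxE [X in X + _]mxE h1 h2 !mxE; ring.
Qed.

Theorem theorem5p1 (R : realType) :
  ~ exists S : set 'rV[R]_4, @C1_submanifold R 2 4 S /\ degree S 2.
Proof.
case=> S [Smfd [[p [Sp _]] deg2]].
have [V [U [phi [Up par]]]] := Smfd _ Sp.
have [oV _ im [C1 _ _]] := par.
have [u Vu _] : (phi @` V) p by rewrite im; split.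
have hor x (Vx : V x) := horizontal_chart deg2 par Vx.
have dcoord i x (Vx : V x) := is_diff_coord i (C1 _ Vx).1.
have dE i x w : V x -> 'd (fun y => phi y 0 i : R) x w = 'd phi x w 0 i.
  move=> Vx; exact: (congr1 (fun L : 'rV[R]_2 -> R => L w)
    (diff_val (is_diff_def := dcoord i _ Vx))).
have nV : \forall x \near u, V x by exact: open_nbhs_nbhs.
have [[v [w /eqP ind]] _] := hor _ Vu; apply: ind.
have dep : 'd (fun y => phi y 0 0 : R) u v * 'd (fun y => phi y 0 1 : R) u w =
    'd (fun y => phi y 0 0 : R) u w * 'd (fun y => phi y 0 1 : R) u v.
  apply: (contact_diff_dependent (h := fun x => phi x 0 2)).
  - exact: (ex_diff (is_diff_def := dcoord 0 _ Vu)).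
  - apply: filterS nV => x Vx; split.
    + exact: (ex_diff (is_diff_def := dcoord 1 _ Vx)).
    + exact: (ex_diff (is_diff_def := dcoord 2 _ Vx)).
    + by move=> y; rewrite !dE //; have [_] := hor _ Vx; exact.
  - move=> y; have [_ /(_ y) cy] := C1 _ Vu.
    have cy1 : {for u, continuous (fun x => 'd phi x y 0 1 : R)}.
      exact: (continuous_comp cy (@coord_continuous R 1 4 0 1 _)).
    apply: near_eq_continuous cy1.
    by apply: filterS nV => x Vx; rewrite dE.
by rewrite !dE // in dep; rewrite dep mulrC.
Qed.
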